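(* Let $S\ne\mathbb{N}$ be a numerical semigroup with $t(S)\ge e(S)$, write $\mathrm{PF}(S)=\{f_1<f_2<\dots<f_{t}\}$ with $t=t(S)$, and put $d=t(S)+1-e(S)\ge1$. Then $$W(S)\;\ge\;\Theta(S)-\sum_{i=1}^{d}\lambda_S(f_i).$$
   Context: $\mathbb{N}=\{0,1,2,\dots\}$. A numerical semigroup is a submonoid $S\subseteq\mathbb{N}$ (under addition) with finite complement $G(S)=\mathbb{N}\setminus S$, whose elements are the gaps. Let $S\ne\mathbb{N}$. $F=\max G(S)$, $c(S)=F+1$, $n(S)=|S\cap[0,c(S))|$, and $e(S)$ is the cardinality of the unique minimal system of generators of $S$. An integer $f$ is a pseudo-Frobenius number if $f\notin S$ and $f+s\in S$ for all $s\in S\setminus\{0\}$; $\mathrm{PF}(S)$ is the set of these and $t(S)=|\mathrm{PF}(S)|$. The Wilf number is $W(S)=e(S)n(S)-c(S)$. For $y\in\mathbb{Z}$, $\lambda_S(y)=|S\cap[0,y]|$; for an integer $x\in[1,F]$, $\nu_S(x)=|\{f\in\mathrm{PF}(S): f-x\in S\}|$; and $\Theta(S)=\sum_{x\in G(S)}(\nu_S(x)-1)$. *)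

(* Defs.v *)
From mathcomp Require Export all_boot all_order all_algebra.
From mathcomp Require Export finmap.
From mathcomp Require Export mathcomp_extra boolp classical_sets functions cardinality.

Set Implicit Arguments.
Unset Strict Implicit.
Unset Printing Implicit Defensive.

Import Order.TTheory GRing.Theory Num.Theory.

Local Open Scope classical_set_scope.
Local Open Scope ring_scope.

(* Throughout, [#|` fset_set A|] is the cardinality of a classical set [A];
   [fset_set] returns [fset0] on infinite sets, but all the sets below are
   finite when [S] is a numerical semigroup different from [setT]. *)

Definition submonoid (M : set nat) : Prop :=
  M 0%N /\ forall x y : nat, M x -> M y -> M (x + y)%N.

Definition numerical_semigroup (S : set nat) : Prop :=
  submonoid S /\ finite_set (~` S).

Definition gaps (S : set nat) : {fset nat} := fset_set (~` S).

Definition frobenius (S : set nat) : nat := (\max_(x <- gaps S) x)%N.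

Definition conductor (S : set nat) : nat := (frobenius S).+1.

Definition n_left (S : set nat) : nat :=
  #|` fset_set [set s : nat | S s /\ (s < conductor S)%N]|.

Definition generates (A S : set nat) : Prop := smallest submonoid A = S.

Definition minimal_generators (A S : set nat) : Prop :=
  generates A S /\ forall B : set nat, B `<=` A -> generates B S -> B = A.

Definition embdim (S : set nat) : nat :=
  #|` fset_set (xget set0 [set A | minimal_generators A S])|.

Definition inZ (S : set nat) : set int := [set s%:Z | s in S].

Definition PF (S : set nat) : set int :=
  [set f : int | ~ inZ S f /\
     forall s : nat, S s -> s <> 0%N -> inZ S (f + s%:Z)].

Definition sg_type (S : set nat) : nat := #|` fset_set (PF S)|.

(* The increasing enumeration of [PF S], indexed from 0: its [i]-th item is
   the element usually written f_(i+1). *)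
Definition PF_seq (S : set nat) : seq int := sort <=%R (fset_set (PF S)).

Definition wilf (S : set nat) : int :=
  (embdim S)%:Z * (n_left S)%:Z - (conductor S)%:Z.

Definition lambda (S : set nat) (y : int) : nat :=
  #|` fset_set [set s : nat | S s /\ s%:Z <= y]|.

Definition nu (S : set nat) (x : nat) : nat :=
  #|` fset_set [set f : int | PF S f /\ inZ S (f - x%:Z)]|.

Definition Theta (S : set nat) : int :=
  \sum_(x <- gaps S) ((nu S x)%:Z - 1).

(* Main.v *)
(** Counting the pairs (x, f) with x a gap, f in PF(S) and f - x in S by f
    instead of by x gives Sum_x nu(x) = Sum_f lambda(f), while the conductor is
    the number of gaps plus n(S).  The claim therefore reduces to
    Sum_(i > d) lambda(f_i) <= (e(S) - 1) n(S); this sum has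
    t(S) - d = e(S) - 1 terms, each at most n(S) because f_i <= F. *)
Require Import Defs.
From mathcomp Require Import zify.
Import Order.TTheory GRing.Theory Num.Theory.
Local Open Scope classical_set_scope.
Local Open Scope ring_scope.

(** Cardinalities become sums of indicators over a common finite set, so that a double count is an
    exchange of two sums. *)
Lemma card_fset_set_sub {T : choiceType} {A B : set T} :
  finite_set A -> B `<=` A ->
  #|` fset_set B| = (\sum_(x <- fset_set A) (x \in B))%N.
Proof.
move=> finA BA; have finB := sub_finite_set BA finA.
have -> : (\sum_(x <- fset_set A) (x \in B) = count (mem B) (fset_set A))%N.
  by rewrite -sum1_count [RHS]big_mkcond; apply: eq_bigr => x _ /=; case: (x \in B).
rewrite -size_filter; apply/perm_size/uniq_perm; rewrite ?filter_uniq ?fset_uniq//.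
move=> x; rewrite mem_filter /= !in_fset_set//.
by apply/idP/andP => [xB|[]//]; split=> //; move: xB; rewrite !inE; apply: BA.
Qed.

Lemma leq_card_fset_set_in {T U : choiceType} {A : set T} {B : set U}
    {h : T -> U} :
  finite_set A -> finite_set B -> {in A &, injective h} ->
  (forall x, A x -> B (h x)) -> (#|` fset_set A| <= #|` fset_set B|)%N.
Proof.
move=> finA finB injh hAB.
rewrite -(size_map h); apply: uniq_leq_size.
  rewrite map_inj_in_uniq ?fset_uniq// => x y; rewrite !in_fset_set//.
  exact: injh.
move=> _ /mapP[x + ->]; rewrite !in_fset_set// !inE; exact: hAB.
Qed.

Lemma finite_set_ltn {A : set nat} (n : nat) :
  (forall x, A x -> (x < n)%N) -> finite_set A.
Proof. by move=> An; apply: sub_finite_set (finite_II n) => x /An. Qed.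

Definition atoms (S : set nat) : set nat :=
  [set a | [/\ S a, a <> 0%N &
     forall x y, S x -> S y -> a = (x + y)%N -> x = 0%N \/ y = 0%N]].

(** Removing an atom [a] from S leaves a submonoid: a sum equal to [a] has a zero term, so its other
    term is [a] itself. If B missed [a], it would generate at most this smaller submonoid. *)
Lemma atoms_sub_generates {S B : set nat} :
  submonoid S -> generates B S -> atoms S `<=` B.
Proof.
move=> [S0 SD] BS a [Sa a0 airr]; apply: contrapT => Ba.
have BsubS : B `<=` S by rewrite -BS; exact: sub_smallest.
suff : smallest submonoid B `<=` S `\ a by rewrite BS => /(_ a Sa)[_]; exact.
apply: smallest_sub.
- split; first by split=> // /esym.
  move=> x y [Sx xa] [Sy ya]; split; first exact: SD.
  move=> /= /esym e; case: (airr _ _ Sx Sy e) => z.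
  + by apply: ya => /=; rewrite e z add0n.
  + by apply: xa => /=; rewrite e z addn0.
- by move=> b Bb; split; [exact: BsubS|move=> /= e; apply: Ba; rewrite -e].
Qed.

(** By strong induction: a nonzero element that is not an atom splits into two strictly smaller
    elements of S. *)
Lemma atoms_generates {S : set nat} : submonoid S -> generates (atoms S) S.
Proof.
move=> smS; have [S0 SD] := smS; rewrite /generates eqEsubset; split.
  by apply: smallest_sub => // a [].
move=> s Ss M [[M0 MD] AM]; elim/ltn_ind: s Ss => s IH Ss.
have [->//|/eqP s0] := eqVneq s 0%N.
have [sirr|] := pselect (forall x y, S x -> S y -> s = (x + y)%N ->
    x = 0%N \/ y = 0%N); first exact: AM.
move=> /existsNP[x /existsNP[y]] /not_implyP[Sx /not_implyP[Sy]].
move=> /not_implyP[e /not_orP[x0 y0]].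
by rewrite e; apply: MD; apply: IH => //; lia.
Qed.

(** The atoms generate S and lie in every generating set, so the choice made in [embdim] is
    forced. *)
Lemma xget_minimal_generators {S : set nat} : submonoid S ->
  xget set0 [set A | minimal_generators A S] = atoms S.
Proof.
move=> smS; apply: xget_unique => [|A [genA minA]] /=.
  split; first exact: atoms_generates.
  move=> B BA genB; apply/seteqP; split=> //; exact: atoms_sub_generates.
apply/esym/minA; first exact: atoms_sub_generates.
exact: atoms_generates.
Qed.

Section NumericalSemigroup.
Context {S : set nat}.
Hypotheses (hS : numerical_semigroup S) (hN : S <> setT).

Let F := frobenius S.

Lemma mem_gaps (x : nat) : (x \in gaps S) = ~~ `[< S x >].
Proof.
rewrite in_fset_set; last by case: hS.
by apply/idP/idP; rewrite inE => /asboolPn.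
Qed.

Lemma gap_le_frobenius (x : nat) : ~ S x -> (x <= F)%N.
Proof.
move=> Sx; apply: (@leq_bigmax_seq _ (gaps S : seq nat) xpredT id) => //.
by rewrite mem_gaps; apply/asboolPn.
Qed.

Lemma gt_frobenius (x : nat) : (F < x)%N -> S x.
Proof.
by move=> Fx; apply: contrapT => /gap_le_frobenius; rewrite leqNgt Fx.
Qed.

Lemma frobenius_gap : ~ S F.
Proof.
have [x Sx] : exists x, ~ S x.
  by apply/existsNP => ST; apply: hN; apply/seteqP; split.
(* The maximum is either a gap or the default 0; in the latter case the gap [x] satisfies [x <= 0],
   so 0 is itself a gap. *)
have [F0|] : F = 0%N \/ F \in gaps S; last by rewrite mem_gaps => /asboolPn.
  rewrite /F /frobenius big_seq; elim/big_ind: _ => [|y z|]; [by left| |by right].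
  by rewrite /maxn; case: ifP.
by have := gap_le_frobenius _ Sx; rewrite F0 leqn0 => /eqP <-.
Qed.

(** This ensures [d <= sg_type S] in the theorem. Finiteness of the atoms comes first, since
    [fset_set] sends an infinite set to [fset0]. *)
Lemma embdim_gt0 : (0 < embdim S)%N.
Proof.
have [smS _] := hS.
have fin : finite_set (atoms S).
  apply: (finite_set_ltn (F.+1 + F.+1)%N) => a [Sa a0 airr].
  rewrite ltnNge; apply/negP => le.
  (* An atom of size at least 2(F + 1) would split into F + 1 and a remainder above F, both nonzero
     elements of S. *)
  have [||||] := airr F.+1 (a - F.+1)%N; try lia; apply: gt_frobenius; lia.
rewrite /embdim xget_minimal_generators//.
rewrite lt0n; apply/eqP => /cardfs0_eq /(fset_set_set0 fin) A0.
have := atoms_generates smS; rewrite /generates A0 => genS.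
have : smallest submonoid set0 F.+1 by rewrite genS; apply: gt_frobenius.
(* Without atoms, S would be contained in the trivial submonoid, which misses F + 1. *)
move=> /(_ [set 0%N]) /= H; suff : F.+1 = 0%N by [].
apply: H; split; last exact: sub0set; split=> //.
by move=> x y -> ->.
Qed.

Lemma PF_bounds (f : int) : PF S f -> 0 < f <= F%:Z.
Proof.
move=> [fS fPF].
have fF : f <= F%:Z.
  rewrite leNgt; apply/negP => Ff; apply: fS; exists `|f|%N; last by lia.
  by apply: gt_frobenius; lia.
rewrite fF andbT ltNge; apply/negP => f0.
have [f0'|fN0] := eqVneq f 0.
  by apply: fS; rewrite f0'; exists 0%N => //; case: hS => -[].
(* For f < 0 the shift F - f exceeds F, hence lies in S, and would carry f to F, a gap. *)
have [||s Ss e] := fPF `|F%:Z - f|%N; [apply: gt_frobenius; lia|lia|].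
by apply: frobenius_gap; have -> : F = s by lia.
Qed.

Lemma finite_PF : finite_set (PF S).
Proof.
apply: (@sub_finite_set _ _ [set k%:Z | k in `I_F.+1]).
  move=> f /PF_bounds fF; exists `|f|%N => /=; lia.
exact: finite_image (finite_II _).
Qed.

Lemma finite_lambda_set (y : int) : finite_set [set s : nat | S s /\ s%:Z <= y].
Proof. by apply: (finite_set_ltn `|y|.+1) => s [_]; lia. Qed.

Lemma lambda_le_n_left (f : int) : PF S f -> (lambda S f <= n_left S)%N.
Proof.
move=> /PF_bounds fF; apply: (leq_card_fset_set_in (h := id)) => //.
- exact: finite_lambda_set.
- by apply: (finite_set_ltn (conductor S)) => s [].
- by move=> s [Ss sf]; split=> //; rewrite /conductor -/F; lia.
Qed.

Lemma conductor_le : (conductor S <= #|` gaps S| + n_left S)%N.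
Proof.
have -> : conductor S = size (iota 0 (conductor S)) by rewrite size_iota.
rewrite -size_cat; apply: uniq_leq_size; first exact: iota_uniq.
move=> x; rewrite mem_iota mem_cat add0n => /= xc.
rewrite mem_gaps; case: asboolP => //= Sx.
rewrite in_fset_set ?inE//.
by apply: (finite_set_ltn (conductor S)) => s [].
Qed.

(** After the exchange of sums, f is fixed and x is sent to f - x: this embeds the gaps x with f - x
    in S into the elements of S up to f. *)
Lemma sum_nu_le :
  (\sum_(x <- gaps S) nu S x <= \sum_(f <- fset_set (PF S)) lambda S f)%N.
Proof.
have PFsub x : [set f : int | PF S f /\ inZ S (f - x%:Z)] `<=` PF S by move=> f [].
under eq_bigr do rewrite /nu (card_fset_set_sub finite_PF (PFsub _)).
rewrite exchange_big /=; rewrite big_seq [leqRHS]big_seq.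
apply: leq_sum => f; rewrite in_fset_set; last exact: finite_PF.
rewrite inE => PFf.
pose A := [set x : nat | ~ S x /\ inZ S (f - x%:Z)].
have finS : finite_set (~` S) by case: hS.
have AS : A `<=` ~` S by move=> x [].
have -> : (\sum_(x <- gaps S)
    (f \in [set f : int | PF S f /\ inZ S (f - x%:Z)%R]) = #|` fset_set A|)%N.
  rewrite (card_fset_set_sub finS AS) big_seq [RHS]big_seq.
  apply: eq_bigr => x; rewrite mem_gaps => /asboolPn Sx.
  by congr (nat_of_bool _); apply/idP/idP; rewrite !inE => -[].
apply: (leq_card_fset_set_in (h := fun x : nat => `|f - x%:Z|%N)).
- by apply: sub_finite_set finS.
- exact: finite_lambda_set.
(* Membership of f - x in S makes it nonnegative, so the absolute value preserves injectivity. *)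
- by move=> x y; rewrite !inE => -[_ [s _ sx]] [_ [s' _ s'y]]; lia.
- by move=> x [_ [s Ss sx]] /=; rewrite -sx; split=> //; lia.
Qed.

Lemma sum_lambda_le (d : nat) : (d <= sg_type S)%N ->
  (\sum_(f <- fset_set (PF S)) lambda S f <=
   \sum_(i < d) lambda S (PF_seq S)`_i + (sg_type S - d) * n_left S)%N.
Proof.
move=> dt.
have szPF : size (PF_seq S) = sg_type S by rewrite size_sort.
rewrite (perm_big (PF_seq S)) /=; last by rewrite perm_sym perm_sort.
rewrite (big_nth 0) szPF (big_cat_nat _ dt)//= big_mkord leq_add2l.
rewrite -sum_nat_const_nat big_nat [leqRHS]big_nat.
apply: leq_sum => i /andP[_ it]; apply: lambda_le_n_left.
have : (PF_seq S)`_i \in PF_seq S by rewrite mem_nth ?szPF.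
rewrite mem_sort in_fset_set ?inE//; exact: finite_PF.
Qed.

End NumericalSemigroup.

Theorem proposition5p1 (S : set nat) (d : nat)
    (hS : numerical_semigroup S) (hN : S <> setT)
    (hte : (embdim S <= sg_type S)%N)
    (hd : d = (sg_type S + 1 - embdim S)%N) :
  Theta S - \sum_(i < d) (lambda S (PF_seq S)`_i)%:Z <= wilf S.
Proof.
have e0 := embdim_gt0 hS.
have dt : (d <= sg_type S)%N by lia.
have td : (sg_type S - d = embdim S - 1)%N by lia.
have := leq_trans (sum_nu_le hS hN) (sum_lambda_le hS hN _ dt).
have := conductor_le hS.
(* Theta becomes the sum of the nu(x) minus the number of gaps. Adding the two bounds leaves (e - 1)
   n + n = e n, a product of variables, hence [nia]. *)
rewrite td /Theta /wilf big_split /= big_const_seq count_predT iter_addr_0.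
rewrite -!(big_morph Posz PoszD (erefl 0%:Z)).
nia.
Qed.
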